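(* Let $W_n$ denote the total number of weak left to right maxima, summed over all Dyck paths of semi-length $n$, and let $\mathrm{WTot}=\sum_{n\ge1}W_n z^{2n}$. Then, with $u$ the power series in $z$ defined by $u=\frac{1-2z^2-\sqrt{1-4z^2}}{2z^2}$ (so that $z^2=\frac{u}{(1+u)^2}$), \[ \mathrm{WTot}=\sum_{r=1}^\infty \frac{(1-u^2)u^r}{1-u^{2+r}}. \]
   Context: A Dyck path of semi-length $n$ is a lattice path from $(0,0)$ to $(2n,0)$ with $n$ up steps $(1,1)$ and $n$ down steps $(1,-1)$ never going below the $x$-axis. A peak is an up step immediately followed by a down step, and its height is the height of its top point. A weak left to right maximum is a peak whose height is greater than or equal to the heights of all peaks to its left. *)

(* Defs.v *)
From HB Require Import structures.
From mathcomp Require Import all_boot all_order all_algebra.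
From mathcomp Require Import boolp.
From mathcomp Require Import ring zify.

(* boolp only supplies function extensionality and the eqType and
   choiceType structures on power series. *)

Set Implicit Arguments.
Unset Strict Implicit.
Unset Printing Implicit Defensive.

Import Order.TTheory GRing.Theory Num.Theory.
Local Open Scope ring_scope.

Record fps (K : Type) : Type := Fps { fcoef : nat -> K }.

HB.instance Definition _ (K : Type) := gen_eqMixin (fps K).
HB.instance Definition _ (K : Type) := gen_choiceMixin (fps K).

Lemma fpsP (K : Type) (f g : fps K) : fcoef f =1 fcoef g -> f = g.
Proof. by case: f g => [f] [g] /= /funext ->. Qed.

Section FpsRing.
Variable K : fieldType.
Implicit Types f g h : fps K.

Definition fps_add f g := Fps (fun k => fcoef f k + fcoef g k).
Definition fps_opp f := Fps (fun k => - fcoef f k).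
Definition fps_zero := Fps (fun=> 0 : K).
Definition fps_one := Fps (fun k => (k == 0%N)%:R : K).
Definition fps_mul f g :=
  Fps (fun k => \sum_(i < k.+1) fcoef f i * fcoef g (k - i)).

Fact fps_addA : associative fps_add.
Proof. by move=> f g h; apply: fpsP => k /=; rewrite addrA. Qed.
Fact fps_addC : commutative fps_add.
Proof. by move=> f g; apply: fpsP => k /=; rewrite addrC. Qed.
Fact fps_add0 : left_id fps_zero fps_add.
Proof. by move=> f; apply: fpsP => k /=; rewrite add0r. Qed.
Fact fps_addN : left_inverse fps_zero fps_opp fps_add.
Proof. by move=> f; apply: fpsP => k /=; rewrite addNr. Qed.

HB.instance Definition _ :=
  GRing.isZmodule.Build (fps K) fps_addA fps_addC fps_add0 fps_addN.

Definition fps_trunc n f : {poly K} := \poly_(i < n) fcoef f i.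

Lemma fps_mul_trunc n k f g :
  (k < n)%N -> fcoef (fps_mul f g) k = (fps_trunc n f * fps_trunc n g)`_k.
Proof.
move=> kn /=; rewrite coefM; apply: eq_bigr => i _.
by rewrite !coef_poly !ifT //; have := ltn_ord i; lia.
Qed.

Lemma coefM_eq (p p' q q' : {poly K}) k :
    (forall i, (i <= k)%N -> p`_i = p'`_i) ->
    (forall i, (i <= k)%N -> q`_i = q'`_i) ->
  (p * q)`_k = (p' * q')`_k.
Proof.
move=> pp' qq'; rewrite !coefM; apply: eq_bigr => i _.
by rewrite pp' ?qq' ?leq_subr // -ltnS.
Qed.

Lemma coef_trunc n f i : (i < n)%N -> (fps_trunc n f)`_i = fcoef f i.
Proof. by move=> lt_in; rewrite coef_poly lt_in. Qed.

Fact fps_mulA : associative fps_mul.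
Proof.
move=> f g h; apply: fpsP => k; rewrite !(@fps_mul_trunc k.+1) //.
transitivity ((fps_trunc k.+1 f * (fps_trunc k.+1 g * fps_trunc k.+1 h))`_k).
  by apply: coefM_eq => // i ik; rewrite coef_trunc // (@fps_mul_trunc k.+1).
rewrite mulrA; apply: coefM_eq => // i ik.
by rewrite coef_trunc // (@fps_mul_trunc k.+1).
Qed.
Fact fps_mulC : commutative fps_mul.
Proof.
by move=> f g; apply: fpsP => k; rewrite !(@fps_mul_trunc k.+1) // mulrC.
Qed.
Fact fps_mul1 : left_id fps_one fps_mul.
Proof.
move=> f; apply: fpsP => k /=; rewrite big_ord_recl /= subn0 mul1r.
by rewrite big1 ?addr0 // => i _; rewrite mul0r.
Qed.
Fact fps_mulDl : left_distributive fps_mul fps_add.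
Proof.
move=> f g h; apply: fpsP => k /=; rewrite -big_split /=.
by apply: eq_bigr => i _; rewrite mulrDl.
Qed.
Fact fps_one_neq0 : fps_one != fps_zero.
Proof.
apply/eqP => /(congr1 (fun f => fcoef f 0)) /= /eqP.
by rewrite oner_eq0.
Qed.

HB.instance Definition _ := GRing.Zmodule_isComNzRing.Build (fps K)
  fps_mulA fps_mulC fps_mul1 fps_mulDl fps_one_neq0.

Lemma fcoef0 k : fcoef (0 : fps K) k = 0. Proof. by []. Qed.
Lemma fcoef1 k : fcoef (1 : fps K) k = (k == 0%N)%:R. Proof. by []. Qed.
Lemma fcoefD f g k : fcoef (f + g) k = fcoef f k + fcoef g k.
Proof. by []. Qed.
Lemma fcoefN f k : fcoef (- f) k = - fcoef f k. Proof. by []. Qed.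
Lemma fcoefB f g k : fcoef (f - g) k = fcoef f k - fcoef g k.
Proof. by []. Qed.
Lemma fcoefM f g k :
  fcoef (f * g) k = \sum_(i < k.+1) fcoef f i * fcoef g (k - i).
Proof. by []. Qed.
Lemma fcoefMn f n k : fcoef (f *+ n) k = fcoef f k *+ n.
Proof. by elim: n => [|n IHn] //; rewrite !mulrS fcoefD IHn. Qed.
Lemma fcoef_sum I (r : seq I) (P : pred I) (F : I -> fps K) k :
  fcoef (\sum_(i <- r | P i) F i) k = \sum_(i <- r | P i) fcoef (F i) k.
Proof. by elim/big_rec2: _ => // i x y _ <-. Qed.
Lemma fcoefM_0 f g : fcoef (f * g) 0 = fcoef f 0 * fcoef g 0.
Proof. by rewrite fcoefM big_ord1. Qed.
Lemma fcoefX_0 f n : fcoef (f ^+ n) 0 = fcoef f 0 ^+ n.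
Proof. by elim: n => [|n IHn] //; rewrite !exprS fcoefM_0 IHn. Qed.

(* The series a with a_n = step [:: a_0; ...; a_{n-1}]. *)
Section Recursion.
Variable step : seq K -> K.

Fixpoint fps_prefix n : seq K :=
  if n is n'.+1 then rcons (fps_prefix n') (step (fps_prefix n')) else [::].

Definition fps_rec := Fps (fun n => step (fps_prefix n)).

Lemma size_fps_prefix n : size (fps_prefix n) = n.
Proof. by elim: n => //= n IHn; rewrite size_rcons IHn. Qed.

Lemma nth_fps_prefix n i : (i < n)%N -> (fps_prefix n)`_i = fcoef fps_rec i.
Proof.
elim: n => // n IHn; rewrite ltnS leq_eqVlt /= nth_rcons size_fps_prefix.
by case: eqVneq => [-> _|_ /= lt_in]; rewrite ?ltnn // lt_in IHn.
Qed.

End Recursion.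

(* f * g = 1 read off in degree n: f_0 g_n + \sum_(i < n) f_{n-i} g_i = [n=0]. *)
Definition fps_recip f : fps K := fps_rec (fun l =>
  (fcoef f 0)^-1 *
  ((size l == 0%N)%:R - \sum_(i < size l) fcoef f (size l - i) * l`_i)).

Definition fps_unit : pred (fps K) := fun f => fcoef f 0 != 0.
(* On non-units the inverse is the identity, as unitRingType prescribes. *)
Definition fps_inv f := if fps_unit f then fps_recip f else f.

Lemma fps_recipE f n : fcoef (fps_recip f) n = (fcoef f 0)^-1 *
  ((n == 0%N)%:R - \sum_(i < n) fcoef f (n - i) * fcoef (fps_recip f) i).
Proof.
rewrite {1}/fps_recip /= size_fps_prefix; congr (_ * (_ - _)).
by apply: eq_bigr => i _; rewrite nth_fps_prefix.
Qed.

Fact fps_mulV : {in fps_unit, left_inverse 1 fps_inv *%R}.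
Proof.
move=> f Uf; rewrite /fps_inv ifT //; apply: fpsP => n.
rewrite fcoefM fcoef1; have := fps_recipE f n.
move: (fps_recip f) => g E; rewrite big_ord_recr /= subnn E mulrAC mulVf //.
rewrite mul1r addrC; under [X in _ + X]eq_bigr do rewrite mulrC.
by rewrite subrK.
Qed.
Fact fps_unitPl f g : g * f = 1 -> fps_unit f.
Proof.
move=> /(congr1 (fun h => fcoef h 0)); rewrite fcoefM_0 fcoef1 /= => fg1.
by apply/eqP => f0; move/eqP: fg1; rewrite f0 mulr0 eq_sym oner_eq0.
Qed.
Fact fps_inv_out : {in [predC fps_unit], fps_inv =1 id}.
Proof. by move=> f /negbTE nUf; rewrite /fps_inv [fps_unit f]nUf. Qed.

HB.instance Definition _ := GRing.ComNzRing_hasMulInverse.Build (fps K)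
  fps_mulV fps_unitPl fps_inv_out.

Lemma fps_unitE f : (f \is a GRing.unit) = (fcoef f 0 != 0). Proof. by []. Qed.

Definition fpsX : fps K := Fps (fun k => (k == 1%N)%:R).

Lemma fcoefXnM f n k :
  fcoef (fpsX ^+ n * f) k = if (k < n)%N then 0 else fcoef f (k - n).
Proof.
elim: n k f => [|n IHn] k f; first by rewrite mul1r subn0.
rewrite exprSr -mulrA IHn fcoefM; have [lt_kn|le_nk] := ltnP k n.
  by rewrite ltnS ltnW.
rewrite ltnS leq_eqVlt orbC ltnNge le_nk /= big_ord_recl mul0r add0r.
have [->|ne_kn] := eqVneq k n; first by rewrite subnn big_ord0.
have -> : (k - n = (k - n.+1).+1)%N by lia.
by rewrite big_ord_recl /= mul1r subSS subn0 big1 ?addr0 // => i _; rewrite mul0r.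
Qed.

(* The quotient f / z^n when z^n divides f (see fps_shiftK). *)
Definition fps_shift n f : fps K := Fps (fun k => fcoef f (k + n)%N).

Lemma fps_shiftK n f :
  (forall k, (k < n)%N -> fcoef f k = 0) -> fpsX ^+ n * fps_shift n f = f.
Proof.
move=> f_lt; apply: fpsP => k; rewrite fcoefXnM.
by case: ltnP => [/f_lt -> //|le_nk] /=; rewrite subnK.
Qed.

(* The square root with constant term 1 of a series f with constant term 1,
   in characteristic other than 2. *)
Definition fps_sqrt f : fps K := fps_rec (fun l =>
  if size l is n.+1 then
    (fcoef f n.+1 - \sum_(i < n) l`_i.+1 * l`_(n - i)) / 2
  else 1).

Lemma fps_sqrt0 f : fcoef (fps_sqrt f) 0 = 1. Proof. by []. Qed.

Lemma fps_sqrtS f n : fcoef (fps_sqrt f) n.+1 =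
  (fcoef f n.+1 - \sum_(i < n)
     fcoef (fps_sqrt f) i.+1 * fcoef (fps_sqrt f) (n - i)) / 2.
Proof.
rewrite {1}/fps_sqrt [LHS]/= -[rcons _ _]/(fps_prefix _ n.+1) size_fps_prefix.
congr ((_ - _) / 2); apply: eq_bigr => i _.
by rewrite !nth_fps_prefix //; have := ltn_ord i; lia.
Qed.

Lemma fps_sqr_sqrt f :
  (2 : K) != 0 -> fcoef f 0 = 1 -> fps_sqrt f ^+ 2 = f.
Proof.
move=> nz2 f0; apply: fpsP => -[|n]; rewrite expr2.
  by rewrite fcoefM_0 fps_sqrt0 mulr1.
rewrite fcoefM; have := fps_sqrtS f n; have := fps_sqrt0 f.
move: (fps_sqrt f) => g g0 E.
rewrite big_ord_recl big_ord_recr subn0 g0 mul1r mulrC subnn g0 mul1r /=.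
have -> : \sum_(i < n) fcoef g (bump 0 i) * fcoef g (n.+1 - bump 0 i) =
    \sum_(i < n) fcoef g i.+1 * fcoef g (n - i) by apply: eq_bigr.
by rewrite /bump add1n E; field.
Qed.

(* F m + F m.+1 + ... = S for the usual (coefficientwise, discrete) topology on
   power series. *)
Definition fps_sums_to (F : nat -> fps K) (m : nat) (S : fps K) : Prop :=
  forall k, exists N, forall M, (N <= M)%N ->
    fcoef (\sum_(m <= r < M) F r) k = fcoef S k.

End FpsRing.

(* A lattice path with 2n steps; [true] is the up step (1,1), [false] the down
   step (1,-1). *)
Definition height (p : seq bool) (i : nat) : int :=
  (count id (take i p))%:Z - (count negb (take i p))%:Z.

Definition dyck (n : nat) : {set n.*2.-tuple bool} :=
  [set p : n.*2.-tuple bool |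
     [&& count id p == n, count negb p == n &
         [forall i : 'I_n.*2.+1, 0 <= height p i]]].

(* Steps i and i+1 (numbered from 0) form a peak, whose top is the point of
   abscissa i+1. The two defaults make the test false beyond the end of p. *)
Definition is_peak (p : seq bool) (i : nat) : bool :=
  nth false p i && ~~ nth true p i.+1.

Definition peak_height (p : seq bool) (i : nat) : int := height p i.+1.

Definition is_weak_lrmax (p : seq bool) (i : nat) : bool :=
  is_peak p i &&
  [forall j : 'I_i, is_peak p j ==> (peak_height p j <= peak_height p i)].

Definition weak_lrmax_count (n : nat) (p : n.*2.-tuple bool) : nat :=
  #|[set i : 'I_n.*2 | is_weak_lrmax p i]|.

Definition W (n : nat) : nat := (\sum_(p in dyck n) weak_lrmax_count p)%N.

Definition WTot : fps rat :=
  Fps (fun k => if (0 < k)%N && ~~ odd k then (W k./2)%:R else 0).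

Lemma WTotE :
  fps_sums_to (fun n => (W n)%:R * fpsX rat ^+ n.*2) 1 WTot.
Proof.
move=> k; exists k.+1 => M le_kM; rewrite fcoef_sum.
have E n : fcoef ((W n)%:R * fpsX rat ^+ n.*2) k =
    if k == n.*2 then (W n)%:R else 0.
  rewrite mulrC fcoefXnM fcoefMn fcoef1; case: ltngtP => // [lt|->].
    by rewrite (_ : (k - n.*2 == 0)%N = false) ?mul0rn //; lia.
  by rewrite subnn.
rewrite (eq_bigr _ (fun n _ => E n)) /=.
case: ifP => [/andP[k_gt0 ev]|nk].
  have kE : k = k./2.*2 by rewrite even_halfK.
  rewrite (bigD1_seq k./2) ?iota_uniq ?mem_index_iota //=; last by lia.
  rewrite -kE eqxx big1 ?addr0 // => i /eqP ne_i; case: eqP => // k_i.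
  by case: ne_i; rewrite k_i doubleK.
rewrite big_nat_cond big1 // => i i_gt0; case: eqP => // ki.
by move: nk; rewrite ki odd_double; lia.
Qed.

(* With z = fpsX rat: (1 - 2z^2 - sqrt(1 - 4z^2)) / (2z^2), dividing by the unit 2,
   then by z^2. *)
Definition u : fps rat :=
  fps_shift 2 ((1 - 2 * fpsX rat ^+ 2 - fps_sqrt (1 - 4 * fpsX rat ^+ 2)) / 2).

Lemma fps_sqrt_disc :
  fps_sqrt (1 - 4 * fpsX rat ^+ 2) ^+ 2 = 1 - 4 * fpsX rat ^+ 2.
Proof.
by apply: fps_sqr_sqrt => //; rewrite fcoefB fcoefM_0 fcoefX_0 mulr0 subr0.
Qed.

Lemma natr_fps_unit n : (n.+1%:R : fps rat) \is a GRing.unit.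
Proof. by rewrite fps_unitE fcoefMn fcoef1 pnatr_eq0. Qed.

Lemma uE : 2 * fpsX rat ^+ 2 * u =
  1 - 2 * fpsX rat ^+ 2 - fps_sqrt (1 - 4 * fpsX rat ^+ 2).
Proof.
rewrite -mulrA /u fps_shiftK; first by rewrite mulrC divrK ?natr_fps_unit.
pose D := 1 - 4 * fpsX rat ^+ 2.
have c j : (j < 2)%N -> fcoef D j = (j == 0%N)%:R.
  move=> lt_j2; rewrite fcoefB mulrC fcoefXnM lt_j2 subr0; exact: fcoef1.
have s1 : fcoef (fps_sqrt D) 1 = 0.
  by rewrite fps_sqrtS big_ord0 c // subr0 mul0r.
have z0 j : (j < 2)%N ->
    fcoef (1 - 2 * fpsX rat ^+ 2 - fps_sqrt D) j = 0.
  move=> lt_j2; rewrite !fcoefB [2 * _]mulrC fcoefXnM lt_j2 subr0 fcoef1.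
  by case: j lt_j2 => [|[|//]] _; rewrite ?fps_sqrt0 ?s1 ?subrr.
move=> k lt_k2; rewrite fcoefM big1 // => i _.
by rewrite z0 ?mul0r //; have := ltn_ord i; lia.
Qed.

Lemma u_quadratic : fpsX rat ^+ 2 * (1 + u) ^+ 2 = u.
Proof.
set z2 := fpsX rat ^+ 2; have := uE; rewrite -/z2 => uE'.
have sE : fps_sqrt (1 - 4 * z2) = 1 - 2 * z2 - 2 * z2 * u.
  by rewrite uE'; ring.
have E : z2 * (4 * (z2 * (1 + u) ^+ 2 - u)) = z2 * 0.
  rewrite mulr0; have := fps_sqrt_disc; rewrite -/z2 sE => /eqP.
  by rewrite -subr_eq0 => /eqP <-; ring.
have : 4 * (z2 * (1 + u) ^+ 2 - u) = 4 * 0.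
  rewrite mulr0; apply: fpsP => k; have := congr1 (fun f => fcoef f k.+2) E.
  by rewrite !fcoefXnM /= subn2.
by move/(mulrI (natr_fps_unit 3))/eqP; rewrite subr_eq0 => /eqP.
Qed.

Lemma fcoef_u0 : fcoef u 0 = 0.
Proof. by rewrite -u_quadratic fcoefXnM. Qed.

Lemma z2E : fpsX rat ^+ 2 = u / (1 + u) ^+ 2.
Proof.
have U : (1 + u) ^+ 2 \is a GRing.unit.
  by rewrite unitrX // fps_unitE fcoefD fcoef1 fcoef_u0 addr0 oner_eq0.
by rewrite -{1}u_quadratic mulrK.
Qed.

(* So that (_ / (1 - u ^+ (2 + r))) is a genuine quotient, not the junk value of
   the inverse on non-units. *)
Lemma denom_unit r : 1 - u ^+ (2 + r) \is a GRing.unit.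
Proof.
by rewrite fps_unitE fcoefB fcoefX_0 fcoef_u0 expr0n subr0 fcoef1 oner_eq0.
Qed.

(* Main.v *)
(** Cut a Dyck path at the top of a weak left to right maximum of height r >= 1.
    The left part is an arbitrary walk from 0 to r inside the strip [0, r], since
    all earlier peaks being at most r means that all earlier points are; the
    right part is a down step followed by an arbitrary nonnegative walk from
    r - 1 to 0. With z^2 (1 + u)^2 = u the generating functions of the two
    parts are z^r (1 + u)^(r+1) (1 - u) / (1 - u^(r+2)) and
    z * z^(r-1) (1 + u)^r, and their product is the r-th term of the series.
    Both come from guessing the solution of the first-step recurrence in the
    starting height and checking it. *)

Require Import Defs.
From mathcomp Require Import all_boot all_order all_algebra.
From mathcomp Require Import ring zify.
Local Open Scope ring_scope.
Import Order.TTheory GRing.Theory Num.Theory.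

(** * Words and walks *)

(** Plain lists, so that words can be cut and extended without the casts that tuples would
    require. *)
Fixpoint words (k : nat) : seq (seq bool) :=
  if k is k'.+1 then map (cons true) (words k') ++ map (cons false) (words k')
  else [:: [::]].

Lemma mem_words k w : (w \in words k) = (size w == k).
Proof.
elim: k w => [|k IHk] w; first by case: w.
rewrite mem_cat; case: w => [|b w]; first by apply/negP => /orP[] /mapP[].
have memE c : (b :: w \in map (cons c) (words k)) = (b == c) && (size w == k).
  rewrite -IHk; apply/mapP/andP => [[x x_k [-> ->]]|[/eqP -> w_k]].
    by rewrite eqxx.
  by exists w.
by rewrite !memE -andb_orl; case: b {memE}.
Qed.

Lemma words_uniq k : uniq (words k).
Proof.
elim: k => //= k IHk; rewrite cat_uniq !map_inj_uniq ?IHk ?andbT /=;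
  try by move=> ? ? [].
by apply/hasPn => _ /mapP[w _ ->]; apply/mapP => -[].
Qed.

Lemma big_wordsS k (F : seq bool -> nat) :
  (\sum_(w <- words k.+1) F w =
   \sum_(w <- words k) F (true :: w) + \sum_(w <- words k) F (false :: w))%N.
Proof. by rewrite /= big_cat !big_map. Qed.

Lemma big_words_cat i j (F : seq bool -> nat) :
  (\sum_(w <- words (i + j)) F w =
   \sum_(q <- words i) \sum_(s <- words j) F (q ++ s))%N.
Proof.
elim: i F => [|i IHi] F; first by rewrite big_seq1.
by rewrite addSn !big_wordsS !IHi.
Qed.

Lemma big_tuple_words k (F : seq bool -> nat) :
  (\sum_(p : k.-tuple bool) F p = \sum_(w <- words k) F w)%N.
Proof.
rewrite -big_enum /= -(big_map val xpredT F); apply: perm_big.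
apply: uniq_perm; [|exact: words_uniq|move=> w].
  by rewrite map_inj_uniq ?enum_uniq //; apply: val_inj.
rewrite mem_words; apply/mapP/eqP => [[p _ ->]|sz_w].
  exact: size_tuple.
by exists (tcast sz_w (in_tuple w)); [rewrite mem_enum|rewrite /= val_tcast].
Qed.

(** The start [h] is a parameter so that removing the first step leaves a walk of the same kind;
    this yields the recurrence for the counts. *)
Fixpoint walk_to0 (h : nat) (w : seq bool) : bool :=
  match w with
  | [::] => h == 0%N
  | true :: w' => walk_to0 h.+1 w'
  | false :: w' => (0 < h)%N && walk_to0 h.-1 w'
  end.

Fixpoint strip_walk (r h : nat) (w : seq bool) : bool :=
  match w with
  | [::] => h == r
  | true :: w' => (h < r)%N && strip_walk r h.+1 w'
  | false :: w' => (0 < h)%N && strip_walk r h.-1 w'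
  end.

(** Each step flips the parity of the height, which ends at 0. This kills the odd coefficients in
    the theorem. *)
Lemma walk_to0_odd h w : walk_to0 h w -> odd (size w) = odd h.
Proof.
elim: w h => [|[] w IHw] h /=; first by move/eqP->.
  by move/IHw=> -> /=; rewrite negbK.
by case: h => //= h /IHw ->.
Qed.

Lemma walk_to0_cat r h q s :
  strip_walk r h q -> walk_to0 h (q ++ s) = walk_to0 r s.
Proof.
elim: q h => [|[] q IHq] h /=; first by move/eqP->.
  by case/andP=> _ /IHq.
by case/andP=> -> /IHq.
Qed.

(** * Heights along a word and the recursive walk predicates *)

Lemma height0 p : height p 0 = 0.
Proof. by rewrite /height take0. Qed.

Lemma height_cons b p i :
  height (b :: p) i.+1 = (if b then 1 else -1) + height p i.
Proof. by rewrite /height; case: b => /=; lia. Qed.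

Lemma height_step d p i : (i < size p)%N ->
  height p i.+1 = height p i + (if nth d p i then 1 else -1).
Proof.
elim: p i => // b p IHp [_|i]; first by rewrite height_cons !height0 addrC.
by rewrite ltnS !height_cons => /IHp ->; rewrite addrA.
Qed.

Lemma height_le p i : height p i <= i%:Z.
Proof.
rewrite /height; have := count_size id (take i p); have := size_take_min i p.
by lia.
Qed.

Lemma height_take p i j : (j <= i)%N -> height (take i p) j = height p j.
Proof. by move=> le_ji; rewrite /height take_takel. Qed.

Lemma walk_to0P h p : reflect
  ((forall i, (i <= size p)%N -> 0 <= h%:Z + height p i) /\
   h%:Z + height p (size p) = 0) (walk_to0 h p).
Proof.
elim: p h => [|b p IHp] h /=.
  have e0 := height0 [::]; apply: (iffP eqP) => [->|[_]]; last by lia.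
  by split=> // -[].
have nnS i : height (b :: p) i.+1 = (if b then 1 else -1) + height p i.
  exact: height_cons.
case: b nnS => nnS.
  apply: (iffP (IHp _)) => -[nn end0].
    split; last by rewrite nnS; lia.
    case=> [|i le_i]; first by rewrite height0; lia.
    by have := nn i le_i; rewrite nnS; lia.
  split; last by move: end0; rewrite nnS; lia.
  by move=> i le_i; have := nn i.+1 le_i; rewrite nnS; lia.
apply: (iffP andP) => [[h_gt0 /IHp[nn end0]]|[nn end0]].
  split; last by rewrite nnS; lia.
  case=> [|i le_i]; first by rewrite height0; lia.
  by have := nn i le_i; rewrite nnS; lia.
have h_gt0 : (0 < h)%N by have := nn 1%N isT; rewrite nnS height0; lia.
split=> //; apply/IHp; split.
  by move=> i le_i; have := nn i.+1 le_i; rewrite nnS; lia.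
by move: end0; rewrite nnS; lia.
Qed.

Lemma strip_walkP r h p : (h <= r)%N -> reflect
  ((forall i, (i <= size p)%N -> 0 <= h%:Z + height p i <= r%:Z) /\
   h%:Z + height p (size p) = r%:Z) (strip_walk r h p).
Proof.
elim: p h => [|b p IHp] h le_hr /=.
  have e0 := height0 [::]; apply: (iffP eqP) => [->|[_]]; last by lia.
  by split=> [[] // _|]; lia.
have nnS i : height (b :: p) i.+1 = (if b then 1 else -1) + height p i.
  exact: height_cons.
case: b nnS => nnS.
  apply: (iffP andP) => [[lt_hr /(IHp _ lt_hr)[nn end0]]|[nn end0]].
    split; last by rewrite nnS; lia.
    case=> [|i le_i]; first by rewrite height0; lia.
    by have := nn i le_i; rewrite nnS; lia.
  have lt_hr : (h < r)%N by have := nn 1%N isT; rewrite nnS height0; lia.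
  split=> //; apply/(IHp _ lt_hr); split; last by move: end0; rewrite nnS; lia.
  by move=> i le_i; have := nn i.+1 le_i; rewrite nnS; lia.
have le_h1 : (h.-1 <= r)%N by lia.
apply: (iffP andP) => [[h_gt0 /(IHp _ le_h1)[nn end0]]|[nn end0]].
  split; last by rewrite nnS; lia.
  case=> [|i le_i]; first by rewrite height0; lia.
  by have := nn i le_i; rewrite nnS; lia.
have h_gt0 : (0 < h)%N by have := nn 1%N isT; rewrite nnS height0; lia.
split=> //; apply/(IHp _ le_h1); split; last by move: end0; rewrite nnS; lia.
by move=> i le_i; have := nn i.+1 le_i; rewrite nnS; lia.
Qed.

Lemma mem_dyck n (p : n.*2.-tuple bool) : (p \in dyck n) = walk_to0 0 p.
Proof.
rewrite inE; have sz := count_predC id p; rewrite size_tuple in sz.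
have heq : height p n.*2 = (count id p)%:Z - (count negb p)%:Z.
  by rewrite /height take_oversize ?size_tuple.
have cE : count (predC id) p = count negb p by apply: eq_count.
rewrite cE in sz.
apply/and3P/walk_to0P => [[/eqP up /eqP dn /forallP nn]|[nn]].
  rewrite size_tuple; split; last by rewrite heq; lia.
  move=> i; rewrite add0r -ltnS => lt_i; exact: (nn (Ordinal lt_i)).
rewrite size_tuple heq => end0; split; try by apply/eqP; lia.
by apply/forallP => i; have := nn i; rewrite add0r size_tuple -ltnS; apply.
Qed.

(** * Splitting a path at a weak left to right maximum *)

(** A point reached by a down step lies below its predecessor; one reached by an up step lies on an
    ascent that ends at a peak no later than [i]. *)
Lemma weak_lrmax_prefix p i : (i.+1 < size p)%N -> 0 <= height p i.+1 ->
  is_weak_lrmax p i ->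
  forall j, (j <= i.+1)%N -> height p j <= height p i.+1.
Proof.
move=> lt_ip nn /andP[pk /forallP max_i].
(* Keep climbing after an up step: the ascent ends at a peak before i, or at i. *)
have after_up d : forall j, (j + d = i)%N -> nth false p j ->
    height p j.+1 <= height p i.+1.
  elim: d => [|d IHd] j jd up_j; first by rewrite -jd addn0.
  have lt_jp : (j.+1 < size p)%N by lia.
  have [up_j1|dn_j1] := boolP (nth false p j.+1).
    have := IHd j.+1; rewrite (height_step false _ j.+1) // up_j1.
    by move=> /(_ ltac:(lia) isT); lia.
  have lt_ji : (j < i)%N by lia.
  have := max_i (Ordinal lt_ji); rewrite /is_peak up_j /=.
  by rewrite (set_nth_default false) // dn_j1.
elim=> [|j IHj] le_j; first by rewrite height0.
have [up_j|dn_j] := boolP (nth false p j).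
  by apply: (after_up (i - j)%N) => //; lia.
have := IHj ltac:(lia); rewrite (height_step false _ j) ?(negbTE dn_j); lia.
Qed.

(** The default [true] rejects the empty word, in agreement with [is_peak]. *)
Definition down_walk_to0 (r : nat) (s : seq bool) : bool :=
  ~~ head true s && walk_to0 r s.

Lemma weak_lrmax_split p i r : (i < size p)%N ->
  strip_walk r.+1 0 (take i.+1 p) && down_walk_to0 r.+1 (drop i.+1 p) =
  [&& walk_to0 0 p, is_weak_lrmax p i & height p i.+1 == r.+1%:Z].
Proof.
move=> lt_ip; have sz : size (take i.+1 p) = i.+1 by rewrite size_takel.
have hd : head true (drop i.+1 p) = nth true p i.+1.
  by rewrite -nth0 nth_drop addn0.
rewrite /down_walk_to0 hd; apply/and3P/and3P => [[st dn nn]|[nn wk /eqP hr]].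
  have nnp : walk_to0 0 p.
    by rewrite -(cat_take_drop i.+1 p) (walk_to0_cat _ _ _ _ st).
  have [bd] := elimT (strip_walkP _ _ _ (leq0n _)) st.
  rewrite sz height_take // add0r => hr.
  have bd' j : (j <= i.+1)%N -> height p j <= r.+1%:Z.
    move=> le_j; have := bd j; rewrite sz height_take // add0r.
    by move=> /(_ le_j) /andP[].
  split; [done | | exact/eqP]; apply/andP; split.
    (* A down step into height r + 1 would start at r + 2, outside the strip. *)
    rewrite /is_peak dn andbT; apply: contraT => dn_i.
    have := bd' i (leqnSn _); move: hr.
    by rewrite (height_step false) // (negbTE dn_i); lia.
  apply/forallP => j; apply/implyP => _; rewrite /peak_height hr.
  by apply: bd'; have := ltn_ord j; lia.
have [/andP[up dn] _] := andP wk.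
have lt_ip1 : (i.+1 < size p)%N.
  by apply: contraNltn dn => le_p; rewrite nth_default.
have [nnh _] := elimT (walk_to0P _ _) nn.
have mx := weak_lrmax_prefix _ _ lt_ip1 _ wk.
have st : strip_walk r.+1 0 (take i.+1 p).
  apply/strip_walkP => //; rewrite sz height_take // add0r; split=> // j le_j.
  rewrite height_take // (le_trans (nnh j _)) ?add0r; try lia.
  by rewrite -hr mx // hr.
split=> //; move: nn.
by rewrite -{1}(cat_take_drop i.+1 p) (walk_to0_cat _ _ _ _ st).
Qed.

(** Only the summand with [r] equal to the height of the peak can be nonzero, and that height lies
    between 1 and the length of [p]. *)
Lemma weak_lrmax_sum M p i : (i < size p)%N -> (size p < M)%N ->
  (walk_to0 0 p && is_weak_lrmax p i : nat) =
  (\sum_(1 <= r < M) (strip_walk r 0 (take i.+1 p) *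
                      down_walk_to0 r (drop i.+1 p)))%N.
Proof.
move=> lt_ip lt_pM; rewrite big_nat_cond.
rewrite (eq_bigr (fun r => (walk_to0 0 p && is_weak_lrmax p i) &&
                           (height p i.+1 == r%:Z) : nat)); last first.
  by move=> [|r] // _; rewrite mulnb weak_lrmax_split // andbA.
rewrite -big_nat_cond; case: andP => [[nn wk]|_]; last by rewrite big1.
have [nnh _] := elimT (walk_to0P _ _) nn.
have [/andP[up dn] _] := andP wk.
have h_gt0 : 0 < height p i.+1.
  by have := nnh i (ltnW lt_ip); rewrite (height_step false) // up; lia.
have h_le := height_le p i.+1.
have [m hm] : exists m : nat, height p i.+1 = m%:Z.
  by exists `|height p i.+1|%N; lia.
rewrite (bigD1_seq m) ?iota_uniq ?mem_index_iota //=; last by lia.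
rewrite hm eqxx big1 // => r ne_r; case: eqP => //; lia.
Qed.

(** * Counting the two parts: a convolution *)

Definition strip_count (r h k : nat) : nat :=
  (\sum_(w <- words k) strip_walk r h w)%N.
Definition to0_count (h k : nat) : nat := (\sum_(w <- words k) walk_to0 h w)%N.
Definition down_to0_count (r k : nat) : nat :=
  (\sum_(w <- words k) down_walk_to0 r w)%N.

Lemma sum_weak_lrmax M k : (k < M)%N ->
  (\sum_(i < k) \sum_(w <- words k) (walk_to0 0 w && is_weak_lrmax w i) =
   \sum_(1 <= r < M) \sum_(i < k)
     strip_count r 0 i.+1 * down_to0_count r (k - i.+1))%N.
Proof.
move=> lt_kM; rewrite [RHS]exchange_big /=; apply: eq_bigr => i _.
have lt_ik := ltn_ord i.
rewrite big_seq (eq_bigr (fun w => \sum_(1 <= r < M)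
   (strip_walk r 0 (take i.+1 w) * down_walk_to0 r (drop i.+1 w)))%N); last first.
  by move=> w; rewrite mem_words => /eqP sz; rewrite -weak_lrmax_sum ?sz.
rewrite -big_seq exchange_big /=; apply: eq_bigr => r _.
rewrite -{1}(subnKC lt_ik) big_words_cat /strip_count big_distrl.
rewrite big_seq [RHS]big_seq; apply: eq_bigr => q.
rewrite mem_words => /eqP sz; rewrite /down_to0_count big_distrr /=.
by apply: eq_bigr => s _; rewrite take_size_cat ?drop_size_cat.
Qed.

Lemma W_words n :
  W n = (\sum_(i < n.*2) \sum_(w <- words n.*2)
           (walk_to0 0 w && is_weak_lrmax w i))%N.
Proof.
rewrite exchange_big /= -(big_tuple_words _ (fun w =>
  \sum_(i < n.*2) (walk_to0 0 w && is_weak_lrmax w i))%N) /W big_mkcond /=.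
apply: eq_bigr => p _; rewrite mem_dyck; case: ifP => _ /=; last by rewrite big1.
rewrite /weak_lrmax_count -sum1_card big_mkcond /=.
by apply: eq_bigr => i _; rewrite inE; case: is_weak_lrmax.
Qed.

(** * Generating functions *)

Lemma strip_count0 r h : strip_count r h 0 = (h == r).
Proof. exact: big_seq1. Qed.

Lemma strip_countS r h k : strip_count r h k.+1 =
  ((h < r) * strip_count r h.+1 k + (0 < h) * strip_count r h.-1 k)%N.
Proof.
rewrite /strip_count big_wordsS !big_distrr /=.
by congr (_ + _)%N; apply: eq_bigr => w _; rewrite mulnb.
Qed.

Lemma to0_count0 h : to0_count h 0 = (h == 0%N).
Proof. exact: big_seq1. Qed.

Lemma to0_countS h k :
  to0_count h k.+1 = (to0_count h.+1 k + (0 < h) * to0_count h.-1 k)%N.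
Proof.
rewrite /to0_count big_wordsS big_distrr /=; congr (_ + _)%N.
by apply: eq_bigr => w _; rewrite mulnb.
Qed.

Lemma down_to0_count0 r : down_to0_count r 0 = 0%N.
Proof. exact: big_seq1. Qed.

Lemma down_to0_countS r k : down_to0_count r.+1 k.+1 = to0_count r k.
Proof. by rewrite /down_to0_count big_wordsS big1. Qed.

Local Notation z := (fpsX rat).

Lemma fcoef_zM0 (f : fps rat) : fcoef (z * f) 0 = 0.
Proof. by rewrite -(expr1 z) fcoefXnM. Qed.

Lemma fcoef_zMS (f : fps rat) k : fcoef (z * f) k.+1 = fcoef f k.
Proof. by rewrite -{1}(expr1 z) fcoefXnM subn1. Qed.

Lemma fcoef_natr n k : fcoef (n%:R : fps rat) k = (n * (k == 0%N))%:R.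
Proof. by rewrite fcoefMn fcoef1 mulnC natrM mulr_natr. Qed.

(** First-passage decomposition: [h] down steps separate [h.+1] Dyck paths, each with generating
    function 1 + u. *)
Definition to0_gf (h : nat) : fps rat := z ^+ h * (1 + u) ^+ h.+1.

Lemma to0_gf_rec h :
  to0_gf h = (h == 0%N)%:R + z * (to0_gf h.+1 + (0 < h)%N%:R * to0_gf h.-1).
Proof.
rewrite /to0_gf; case: h => [|h] /=.
  (* [ring] does not know the relation between z and u, so z^2 (1 + u)^2 is isolated for
     [u_quadratic] to rewrite. *)
  transitivity (1 + z ^+ 2 * (1 + u) ^+ 2); first by rewrite u_quadratic; ring.
  by ring.
transitivity (z ^+ h.+1 * (1 + u) ^+ h.+1 * (1 + z ^+ 2 * (1 + u) ^+ 2)).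
  by rewrite u_quadratic !exprS; ring.
by rewrite !exprS; ring.
Qed.

(** The factor z makes the recurrence determine degree k + 1 from degree k, for all [h] at once, so
    it has a single solution. *)
Lemma fcoef_to0_gf h k : fcoef (to0_gf h) k = (to0_count h k)%:R.
Proof.
elim: k h => [|k IHk] h; rewrite to0_gf_rec fcoefD fcoef_natr.
  by rewrite fcoef_zM0 addr0 muln1 to0_count0.
rewrite fcoef_zMS muln0 add0r fcoefD to0_countS natrD IHk.
by congr (_ + _); case: h => [|h]; [rewrite mul0r | rewrite mul1r mul1n IHk].
Qed.

(** With x = z (1 + u), so that x^2 = u and x = z (1 + x^2), this is, up to a factor free of h,
    x^(-h-1) - x^(h+1): the solution of a_h = z (a_(h+1) + a_(h-1)) that vanishes at h = -1. The
    common denominator is left out so that the recurrence becomes a polynomial identity. *)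
Definition strip_num (r h : nat) : fps rat :=
  z ^+ (r - h) * (1 + u) ^+ (r - h).+1 * (1 - u ^+ h.+1).

Lemma strip_num_rec r h : (h <= r)%N ->
  strip_num r h = (h == r)%:R * (1 - u ^+ (2 + r)) +
    z * ((h < r)%N%:R * strip_num r h.+1 + (0 < h)%N%:R * strip_num r h.-1).
Proof.
move=> le_hr; rewrite /strip_num.
(* This removes truncated subtraction; [d] = 0 is the top of the strip, where the inhomogeneous term
   appears. *)
have [d rE] : exists d, r = (h + d)%N by exists (r - h)%N; lia.
rewrite {r le_hr}rE; case: d => [|d].
  rewrite addn0 eqxx ltnn subnn mul0r add0r; case: h => [|h] /=.
    by rewrite !exprS; ring.
  rewrite (_ : h.+1 - h = 1)%N; last by lia.
  transitivity (1 - u ^+ (2 + h.+1) + z ^+ 2 * (1 + u) ^+ 2 * (1 - u ^+ h.+1)).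
    by rewrite u_quadratic !exprS; ring.
  by rewrite !exprS; ring.
have -> : (h == h + d.+1)%N = false by lia.
have -> : (h < h + d.+1)%N by lia.
have -> : (h + d.+1 - h = d.+1)%N by lia.
have -> : (h + d.+1 - h.+1 = d)%N by lia.
case: h => [|h] /=; first by rewrite !exprS; ring.
rewrite (_ : h.+1 + d.+1 - h = d.+2)%N; last by lia.
transitivity (z ^+ d.+1 * (1 + u) ^+ d.+1 *
  (1 - u ^+ h.+3 + z ^+ 2 * (1 + u) ^+ 2 * (1 - u ^+ h.+1))).
  by rewrite u_quadratic !exprS; ring.
by rewrite !exprS; ring.
Qed.

Definition strip_gf (r h : nat) : fps rat :=
  strip_num r h / (1 - u ^+ (2 + r)).

Lemma strip_gf_rec r h : (h <= r)%N ->
  strip_gf r h = (h == r)%:R +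
    z * ((h < r)%N%:R * strip_gf r h.+1 + (0 < h)%N%:R * strip_gf r h.-1).
Proof.
move=> le_hr; rewrite /strip_gf strip_num_rec // mulrDl mulrK ?denom_unit //.
by congr (_ + _); rewrite -mulrA mulrDl -!mulrA.
Qed.

Lemma fcoef_strip_gf r h k : (h <= r)%N ->
  fcoef (strip_gf r h) k = (strip_count r h k)%:R.
Proof.
elim: k h => [|k IHk] h le_hr; rewrite strip_gf_rec // fcoefD fcoef_natr.
  by rewrite fcoef_zM0 addr0 muln1 strip_count0.
rewrite fcoef_zMS muln0 add0r fcoefD strip_countS natrD; congr (_ + _).
  have [lt_hr|_] := ltnP h r; last by rewrite mul0r.
  by rewrite mul1r mul1n IHk.
case: h le_hr => [|h] lt_hr; first by rewrite mul0r.
by rewrite mul1r mul1n IHk // ltnW.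
Qed.

Lemma strip_gf_to0_gf r : (0 < r)%N ->
  (1 - u ^+ 2) * u ^+ r / (1 - u ^+ (2 + r)) =
  strip_gf r 0 * (z * to0_gf r.-1).
Proof.
case: r => // r _; rewrite /strip_gf [RHS]mulrAC; congr (_ / _).
(* Only this power of u is expanded; the factor 1 - u^2 splits as (1 + u)(1 - u), and both sides
   then agree as polynomials in z and u. *)
have -> : u ^+ r.+1 = (z ^+ 2 * (1 + u) ^+ 2) ^+ r.+1 by rewrite u_quadratic.
rewrite /strip_num /to0_gf subn0 exprMn -!exprM mulnC !muln2 -!addnn !exprD.
by rewrite /= !exprS; ring.
Qed.

Lemma fcoef_term r k : (0 < r)%N ->
  fcoef ((1 - u ^+ 2) * u ^+ r / (1 - u ^+ (2 + r))) k =
  (\sum_(i < k) strip_count r 0 i.+1 * down_to0_count r (k - i.+1))%N%:R.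
Proof.
move=> r_gt0; rewrite strip_gf_to0_gf // fcoefM big_ord_recl.
(* The degree 0 term of the left factor vanishes: an empty walk cannot climb from 0 to r > 0. *)
rewrite fcoef_strip_gf // strip_count0 ltn_eqF // mul0r add0r natr_sum.
apply: eq_bigr => i _; rewrite fcoef_strip_gf // natrM; congr (_ * _).
case: r r_gt0 => // r _; rewrite lift0.
case: (k - i.+1)%N => [|j]; first by rewrite fcoef_zM0 down_to0_count0.
by rewrite fcoef_zMS fcoef_to0_gf down_to0_countS.
Qed.

Theorem theorem8 :
  fps_sums_to (fun r : nat => (1 - u ^+ 2) * u ^+ r / (1 - u ^+ (2 + r))) 1 WTot.
Proof.
(* A path with k steps has no peak higher than k, so every bound M > k captures all
   contributions. *)
move=> k; exists k.+1 => M lt_kM; rewrite fcoef_sum.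
rewrite big_nat_cond (eq_bigr (fun r =>
  (\sum_(i < k) strip_count r 0 i.+1 * down_to0_count r (k - i.+1))%N%:R));
  last first.
  by move=> r /andP[/andP[r_gt0 _] _]; rewrite fcoef_term.
rewrite -big_nat_cond -natr_sum -sum_weak_lrmax //=.
have [odd_k|even_k] := boolP (odd k); last first.
  (* [WTot] has constant term 0 by definition; on the other side, the empty path has no peak. *)
  have [->|k_gt0] := posnP k; first by rewrite big_ord0.
  by rewrite W_words even_halfK.
rewrite andbF big1 // => i _; rewrite big_seq big1 // => w.
rewrite mem_words => /eqP sz; case: (boolP (walk_to0 0 w)) => //.
by move/walk_to0_odd; rewrite sz odd_k.
Qed.
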